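(* In the coordinates $(u,v,t)$, the set of unit rectangles in $\Pi$ is an algebraic curve given by the intersection of the surfaces defined by $$2u^2+2\mu t^2=1 \quad\text{and}\quad 2v^2+2\lambda t^2=1.$$ Each of these surfaces is an elliptical cylinder or a pair of parallel planes. The first surface is the set of parallelograms in $\Pi$ whose $BD$ diagonal has squared length $1/2$, and the second is the set of parallelograms in $\Pi$ whose $AC$ diagonal has squared length $1/2$.
   Context: Setting. $A,B,C,D$ are lines in $\mathbb{R}^2$ with equations $A: y=m_Ax+b_A$, $B: y=m_Bx+1$, $C: y=m_Cx$, $D: y=m_Dx$ (real $m_A,m_B,m_C,m_D,b_A$), such that the four lines do not all meet in a single point and $C,D$ meet only in the origin ($m_C\neq m_D$). $\mathbf{C}$ denotes the configuration consisting of the two pairs $A,C$ and $B,D$. For $w\in\mathbb{R}$: $A(w): y=m_Ax+b_Aw$, $B(w): y=m_Bx+w$, $C(w)=C$, $D(w)=D$, and $\mathbf{C}(w)$ is the resulting configuration. A parallelogram inscribed in $\mathbf{C}(w)$ has vertices $(x_L,y_L)\in L(w)$, $L\in\{A,B,C,D\}$, in this sequence, i.e. $(x_A,y_A)+(x_C,y_C)=(x_B,y_B)+(x_D,y_D)$; degenerate parallelograms (all sides on one line, or a single point) are allowed. $\Pi$ is the set of parallelograms inscribed in $\mathbf{C}(w)$ for some $w\in\mathbb{R}$ ($w$ is then the scale), a real vector space under coordinatewise operations on vertices. For $P\in\Pi$, $P_{AC}=(x_A-x_C,y_A-y_C)$ and $P_{BD}=(x_B-x_D,y_B-y_D)$ are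 the diagonal vectors. The inner product is $\langle P,Q\rangle=P_{AC}\cdot Q_{AC}+P_{BD}\cdot Q_{BD}$, with norm $\|P\|=\langle P,P\rangle^{1/2}$. A rectangle in $\Pi$ is a parallelogram (possibly degenerate) whose diagonals have equal length; a unit rectangle is a rectangle of norm $1$. Basis and coordinates. $\Pi$ is three-dimensional and has an orthonormal basis $U,V,T$ with $U,V$ degenerate, $U_{AC}=V_{BD}=\mathbf{0}$, and $T_{AC}\cdot V_{AC}=T_{BD}\cdot U_{BD}=0$; such a basis is fixed. $(u,v,t)$ denotes the parallelogram $uU+vV+tT$. Put $\lambda=T_{AC}\cdot T_{AC}$ and $\mu=T_{BD}\cdot T_{BD}$, so $\lambda+\mu=1$. *)

(* Defs.v *)
From HB Require Import structures.
From mathcomp Require Import all_boot all_order all_algebra.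
From mathcomp Require Import boolp classical_sets reals.
From mathcomp Require Import mpoly.

Set Implicit Arguments.
Unset Strict Implicit.
Unset Printing Implicit Defensive.

Import Order.TTheory GRing.Theory Num.Theory.
Local Open Scope classical_set_scope.
Local Open Scope ring_scope.

Definition dot (R : realType) (n : nat) (x y : 'rV[R]_n) : R :=
  \sum_(i < n) x 0 i * y 0 i.

Definition len (R : realType) (n : nat) (x : 'rV[R]_n) : R :=
  Num.sqrt (dot x x).

Definition line (R : realType) (m b : R) : set 'rV[R]_2 :=
  [set p | p 0 1 = m * p 0 0 + b].

(* The vertices are listed in the cyclic order A, B, C, D; the product
   structure provides the coordinatewise vector space operations. *)
Definition quad (R : realType) : vectType R :=
  ('rV[R]_2 * 'rV[R]_2 * 'rV[R]_2 * 'rV[R]_2)%type.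

Section Quadrilaterals.
Variable R : realType.
Implicit Types P Q : quad R.

Definition vertA P : 'rV[R]_2 := P.1.1.1.
Definition vertB P : 'rV[R]_2 := P.1.1.2.
Definition vertC P : 'rV[R]_2 := P.1.2.
Definition vertD P : 'rV[R]_2 := P.2.

Definition parallelogram P : Prop := vertA P + vertC P = vertB P + vertD P.

(* The direction d may be 0, so a quadruple of equal points is degenerate. *)
Definition degenerate P : Prop :=
  exists p d : 'rV[R]_2,
    [/\ exists s : R, vertA P = p + s *: d,
        exists s : R, vertB P = p + s *: d,
        exists s : R, vertC P = p + s *: d
      & exists s : R, vertD P = p + s *: d].

Definition inscribed (mA mB mC mD bA w : R) P : Prop :=
  parallelogram P /\
  [/\ line mA (bA * w) (vertA P), line mB w (vertB P),
      line mC 0 (vertC P) & line mD 0 (vertD P)].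

Definition Pi (mA mB mC mD bA : R) : set (quad R) :=
  [set P | exists w : R, inscribed mA mB mC mD bA w P].

Definition diagAC P : 'rV[R]_2 := vertA P - vertC P.
Definition diagBD P : 'rV[R]_2 := vertB P - vertD P.

Definition inner P Q : R :=
  dot (diagAC P) (diagAC Q) + dot (diagBD P) (diagBD Q).

Definition qnorm P : R := Num.sqrt (inner P P).

Definition rectangle P : Prop :=
  parallelogram P /\ len (diagAC P) = len (diagBD P).

Definition unit_rectangle P : Prop := rectangle P /\ qnorm P = 1.

Definition is_basis (W : set (quad R)) (s : seq (quad R)) : Prop :=
  free s /\ W = [set P | P \in <<s>>%VS].

Definition orthonormal3 (U V T : quad R) : Prop :=
  [/\ inner U U = 1, inner V V = 1 & inner T T = 1] /\
  [/\ inner U V = 0, inner U T = 0 & inner V T = 0].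

(* The row vector p lists the coordinates (u, v, t). *)
Definition of_coords (U V T : quad R) (p : 'rV[R]_3) : quad R :=
  p 0 0 *: U + p 0 1 *: V + p 0 2 *: T.

Definition in_coords (U V T : quad R) (W : set (quad R)) : set 'rV[R]_3 :=
  of_coords U V T @^-1` W.

End Quadrilaterals.

Section AlgebraicSets.
Variables (R : realType) (n : nat).
Implicit Types X : set 'rV[R]_n.

Definition mpeval (f : {mpoly R[n]}) (p : 'rV[R]_n) : R :=
  meval (fun i => p 0 i) f.

Definition algebraic_set X : Prop :=
  exists s : seq {mpoly R[n]},
    X = [set p | forall f, f \in s -> mpeval f p = 0].

(* The polynomial functions f_1, ..., f_d are algebraically independent over R
   in the coordinate ring of X. *)
Definition alg_independent_on X (d : nat) (f : 'I_d -> {mpoly R[n]}) : Prop :=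
  forall F : {mpoly R[d]},
    (forall p, X p -> meval (fun i => mpeval (f i) p) F = 0) -> F = 0.

(* The dimension of an algebraic set is the transcendence degree of its
   coordinate ring. *)
Definition algebraic_dim X (d : nat) : Prop :=
  (exists f : 'I_d -> {mpoly R[n]}, alg_independent_on X f) /\
  (forall e (f : 'I_e -> {mpoly R[n]}),
     alg_independent_on X f -> (e <= d)%N).

Definition algebraic_curve X : Prop := algebraic_set X /\ algebraic_dim X 1.

End AlgebraicSets.

Section Surfaces.
Variable R : realType.
Implicit Types S : set 'rV[R]_3.

(* A right cylinder over an ellipse with centre c and semi-axes a, b along
   e1, e2; the lines of the cylinder are parallel to e3.  Circles count as
   ellipses. *)
Definition elliptical_cylinder S : Prop :=
  exists (c e1 e2 e3 : 'rV[R]_3) (a b : R),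
    [/\ [/\ dot e1 e1 = 1, dot e2 e2 = 1 & dot e3 e3 = 1],
        [/\ dot e1 e2 = 0, dot e1 e3 = 0 & dot e2 e3 = 0],
        0 < a, 0 < b
      & S = [set p | exists x y z : R,
               x ^+ 2 / a ^+ 2 + y ^+ 2 / b ^+ 2 = 1 /\
               p = c + x *: e1 + y *: e2 + z *: e3]].

Definition parallel_planes S : Prop :=
  exists (e : 'rV[R]_3) (c1 c2 : R),
    [/\ e != 0, c1 != c2
      & S = [set p | dot e p = c1] `|` [set p | dot e p = c2]].

End Surfaces.

(* Main.v *)
(* Since U_AC = V_BD = 0, the diagonals of (u, v, t) have squared lengths
   v ^ 2 + lam t ^ 2 and u ^ 2 + mu t ^ 2.  For a unit rectangle these are equal
   with sum 1, so both are 1 / 2, and the equations of the surfaces follow.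
   The intersection X of the surfaces has dimension 1: t takes infinitely many
   values on X, so t is transcendental there; conversely u ^ 2 and v ^ 2 are
   polynomials in t on X, so a polynomial function of degree < D on X is a
   combination of the 4 D functions t ^ k u ^ a v ^ b with a, b < 2 and k < D,
   and counting monomials shows that any two of them are dependent. *)
Require Import Defs.
From HB Require Import structures.
From mathcomp Require Import all_boot all_order all_algebra.
From mathcomp Require Import boolp classical_sets reals.
From mathcomp Require Import mpoly ring lra zify.

Set Implicit Arguments.
Unset Strict Implicit.
Unset Printing Implicit Defensive.

Import Order.TTheory GRing.Theory Num.Theory.
Local Open Scope classical_set_scope.
Local Open Scope ring_scope.

(** * Linear dependence, degree bounds and infinitely many zeros *)

(** A matrix with more rows than columns is not row free, so its left kernel contains a nonzero
    vector. *)
Lemma linear_system_nontrivial (F : fieldType) (I J : finType)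
    (M : I -> J -> F) : (#|J| < #|I|)%N ->
  exists c : I -> F, (exists i, c i != 0) /\ forall j, \sum_i c i * M i j = 0.
Proof.
move=> ltJI; pose A := \matrix_(i < #|I|, j < #|J|) M (enum_val i) (enum_val j).
have /rowV0Pn[x /sub_kermxP xA0 /rV0Pn[i xi0]] : kermx A != 0.
  rewrite kermx_eq0 /row_free neq_ltn.
  by rewrite (leq_ltn_trans (rank_leq_col A)).
exists (fun i => x 0 (enum_rank i)); split.
  by exists (enum_val i); rewrite enum_valK.
move=> j; have := congr1 (fun y : 'rV_#|J| => y 0 (enum_rank j)) xA0.
rewrite !mxE => xAj.
rewrite -[RHS]xAj (reindex (@enum_val I I)) /=; last first.
  by exists enum_rank => k _; rewrite ?enum_valK ?enum_rankK.
by apply: eq_bigr => k _; rewrite !mxE enum_valK enum_rankK.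
Qed.

(** A crude bound, linear in the exponents, is all that the later counting of monomials needs. *)
Lemma msizeM_exp_le (n : nat) (R : nzRingType) (f g : {mpoly R[n]})
    (d i j : nat) : (msize f < d)%N -> (msize g < d)%N ->
  (msize (f ^+ i * g ^+ j) <= (i + j) * d + 3)%N.
Proof.
have aux (h : {mpoly R[n]}) k :
    (msize h < d)%N -> (msize (h ^+ k) <= k * d + 1)%N.
  move=> hd; elim: k => [|k IHk]; first by rewrite expr0 msize1.
  rewrite exprS; apply: leq_trans (msizeM_le _ _) _.
  by rewrite mulSn; lia.
move=> fd gd; apply: leq_trans (msizeM_le _ _) _.
by have := aux _ i fd; have := aux _ j gd; rewrite mulnDl; lia.
Qed.

Lemma poly_infinite_roots (F : idomainType) (p : {poly F}) (x : nat -> F) :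
  injective x -> (forall n, root p (x n)) -> p = 0.
Proof.
move=> x_inj px; apply: (@roots_geq_poly_eq0 _ _ (map x (iota 0 (size p)))).
- by apply/allP => _ /mapP[n _ ->].
- by rewrite map_inj_uniq // iota_uniq.
- by rewrite size_map size_iota.
Qed.

(** A monomial in one variable is determined by its exponent, so [f] becomes a univariate polynomial
    with the same values and coefficients. *)
Lemma mpoly1_infinite_roots (F : idomainType) (f : {mpoly F[1]}) (x : nat -> F) :
  injective x -> (forall n, meval (fun=> x n) f = 0) -> f = 0.
Proof.
move=> x_inj fx.
pose p : {poly F} := \sum_(m <- msupp f) f@_m *: 'X^(m ord0).
have p0 : p = 0.
  apply: (poly_infinite_roots x_inj) => n; apply/eqP; rewrite -[RHS](fx n).
  rewrite horner_sum mevalE; apply: eq_bigr => m _.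
  by rewrite hornerZ hornerXn big_ord1.
apply/mpolyP => m; rewrite mcoeff0.
case: (boolP (m \in msupp f)) => [mf|]; last exact: memN_msupp_eq0.
have := congr1 (fun q : {poly F} => q`_(m ord0)) p0.
rewrite coef0 coef_sum (bigD1_seq m) //= coefZ coefXn eqxx mulr1 big1 ?addr0 //.
move=> k km; rewrite coefZ coefXn; case: eqP => [e|]; last by rewrite mulr0.
by case/eqP: km; apply/mnmP => i; rewrite ord1 e.
Qed.

(** * Upper bound on the dimension *)

Section Curve.
Variables (R : realType) (q1 q2 : {poly R}) (X : set 'rV[R]_3).
Hypotheses (q1_size : (size q1 <= 3)%N) (q2_size : (size q2 <= 3)%N).
Hypothesis X1 : forall p, X p -> p 0 0 ^+ 2 = q1.[p 0 2].
Hypothesis X2 : forall p, X p -> p 0 1 ^+ 2 = q2.[p 0 2].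

(* Even powers of the first two coordinates can be traded for polynomials in
   the third one without raising the degree. *)
Lemma reduce_on_curve (g : {mpoly R[3]}) (D : nat) : (msize g <= D)%N ->
  exists c : bool * bool * 'I_D -> R, forall p, X p ->
    mpeval g p =
      \sum_j c j * (p 0 0 ^+ j.1.1 * p 0 1 ^+ j.1.2 * p 0 2 ^+ j.2).
Proof.
move=> gD.
(* [Q m] is what the monomial [m] contributes in the third coordinate once all squares are traded;
   the parities of the first two exponents remain and select the class in [c]. *)
pose Q (m : 'X_{1..3}) : {poly R} := q1 ^+ (m 0)./2 * q2 ^+ (m 1)./2 * 'X^(m 2).
pose c (m : 'X_{1..3}) (j : bool * bool * 'I_D) : R :=
  ((odd (m 0), odd (m 1)) == j.1)%:R * (Q m)`_(j.2).
exists (fun j => \sum_(m <- msupp g) g@_m * c m j) => p Xp.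
rewrite /mpeval mevalE; under [RHS]eq_bigr do rewrite mulr_suml.
rewrite exchange_big /=; apply: eq_big_seq => m mg.
under [RHS]eq_bigr => j _ do rewrite -(mulrA g@_m (c m j)).
rewrite -mulr_sumr; congr (_ * _).
(* Each traded square has degree 2 and is replaced by a polynomial of degree at most 2, so the
   degree of [Q m] is at most that of [m]. *)
have Qsize : (size (Q m) <= D)%N.
  have := msize_mdeg_lt mg; rewrite mdegE !big_ord_recl big_ord0.
  rewrite (_ : ord0 = 0) // (_ : lift 0 0 = 1); last exact/val_inj.
  rewrite (_ : lift 0 (lift ord0 0) = 2); last exact/val_inj.
  have := size_polyMleq (q1 ^+ (m 0)./2 * q2 ^+ (m 1)./2) 'X^(m 2).
  have := size_polyMleq (q1 ^+ (m 0)./2) (q2 ^+ (m 1)./2).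
  have := size_poly_exp_leq q1 (m 0)./2.
  have := size_poly_exp_leq q2 (m 1)./2.
  rewrite size_polyXn -/(Q m).
  have := odd_double_half (m 0); have := odd_double_half (m 1).
  move: q1_size q2_size gD; nia.
rewrite -(pair_bigA _ (fun ab k => c m (ab, k) *
  (p 0 0 ^+ ab.1 * p 0 1 ^+ ab.2 * p 0 2 ^+ k))) /=.
rewrite (bigD1 (odd (m 0), odd (m 1))) //= [X in _ + X]big1 ?addr0; last first.
  by move=> ab /negbTE nab; rewrite big1 // => k _; rewrite /c /= eq_sym nab !mul0r.
transitivity (p 0 0 ^+ odd (m 0) * p 0 1 ^+ odd (m 1) * (Q m).[p 0 2]).
  rewrite !hornerM !horner_exp hornerX -X1 // -X2 //.
  rewrite !big_ord_recl big_ord0.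
  rewrite (_ : ord0 = 0) // (_ : lift 0 0 = 1); last exact/val_inj.
  rewrite (_ : lift 0 (lift ord0 0) = 2); last exact/val_inj.
  rewrite -[in LHS](odd_double_half (m 0)) -[in LHS](odd_double_half (m 1)).
  by rewrite !exprD -!mul2n !exprM; ring.
rewrite (horner_coef_wide _ Qsize) mulr_sumr.
by apply: eq_bigr => k _; rewrite /c /= eqxx mul1r; ring.
Qed.

(* There are N ^ 2 products f_0 ^ i * f_1 ^ j with i, j < N, while the space
   containing them has dimension at most 4 D with D linear in N. *)
Lemma curve_independent_le1 (e : nat) (f : 'I_e -> {mpoly R[3]}) :
  alg_independent_on X f -> (e <= 1)%N.
Proof.
(* With at least two functions, the first two already satisfy a nontrivial relation. *)
case: e f => [|[|e]] // f f_indep; exfalso.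
pose f0 := f ord0; pose f1 := f (lift ord0 ord0).
pose d := (maxn (msize f0) (msize f1)).+1.
(* Chosen so that [N ^ 2 = 8 * d * N + 12 * N] exceeds [4 * D = 8 * d * N + 12]. *)
pose N := (8 * d + 12)%N; pose D := (2 * N * d + 3)%N.
have f_size (i j : 'I_N) : (msize (f0 ^+ i * f1 ^+ j) <= D)%N.
  apply: leq_trans (@msizeM_exp_le _ _ f0 f1 d i j _ _) _.
  - by rewrite ltnS leq_maxl.
  - by rewrite ltnS leq_maxr.
  - by rewrite leq_add2r leq_mul2r; have := ltn_ord i; have := ltn_ord j; lia.
have /boolp.choice[M ME] (ij : 'I_N * 'I_N) := reduce_on_curve (f_size ij.1 ij.2).
have [|c [[[i0 j0] c0] cM]] :=
  @linear_system_nontrivial R ('I_N * 'I_N)%type (bool * bool * 'I_D)%type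
    M.
  by rewrite !card_prod !card_ord !card_bool /D /N; nia.
pose mon (ij : 'I_N * 'I_N) : 'X_{1..e.+2} :=
  (U_(ord0) *+ ij.1 + U_(lift ord0 ord0) *+ ij.2)%MM.
have mon_inj : injective mon.
  move=> [i j] [i' j'] /mnmP eq_mon.
  have := eq_mon ord0; have := eq_mon (lift ord0 ord0).
  rewrite !mnmDE !mulmnE !mnm1E /= !mul0n !mul1n !addn0 !add0n => ej ei.
  by congr pair; apply/val_inj.
(* The monomials [mon ij] are distinct, so the coefficients of [F] are the [c ij], not all zero,
   although [F] gives a relation on [X]. *)
pose F : {mpoly R[e.+2]} := \sum_ij c ij *: 'X_[mon ij].
have /mpolyP/(_ (mon (i0, j0))) : F = 0.
  apply: f_indep => p Xp.
  rewrite raddf_sum /=.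
  transitivity (\sum_ij c ij * mpeval (f0 ^+ ij.1 * f1 ^+ ij.2) p).
    apply: eq_bigr => ij _; rewrite mevalZ; congr (_ * _).
    rewrite /mon mpolyXD -!mpolyXn mevalM /mpeval mevalM.
    by rewrite !rmorphXn /= !mevalXU.
  under eq_bigr do rewrite (ME _ _ Xp) mulr_sumr.
  rewrite exchange_big big1 //= => j _.
  pose y := p 0 0 ^+ j.1.1 * p 0 1 ^+ j.1.2 * p 0 2 ^+ j.2.
  transitivity ((\sum_ij c ij * M ij j) * y); last by rewrite cM mul0r.
  by rewrite mulr_suml; apply: eq_bigr => ij _; rewrite -(mulrA _ _ y).
rewrite mcoeff0 raddf_sum /= (bigD1 (i0, j0)) //= mcoeffZ mcoeffX eqxx mulr1.
rewrite big1 ?addr0 => [/eqP|ij nij]; first exact/negP.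
by rewrite mcoeffZ mcoeffX inj_eq // (negbTE nij) mulr0.
Qed.

End Curve.

(** * The intersection of the surfaces is a curve *)

Lemma cylinders_meet_in_curve (R : realType) (lam mu : R) :
  0 <= lam <= 1 -> 0 <= mu <= 1 ->
  algebraic_curve
    ([set p : 'rV[R]_3 | 2 * p 0 0 ^+ 2 + 2 * mu * p 0 2 ^+ 2 = 1] `&`
     [set p : 'rV[R]_3 | 2 * p 0 1 ^+ 2 + 2 * lam * p 0 2 ^+ 2 = 1]).
Proof.
move=> /andP[lam0 lam1] /andP[mu0 mu1]; set X := _ `&` _.
split; [|split].
- exists [:: 2 *: 'X_0 ^+ 2 + (2 * mu) *: 'X_2 ^+ 2 - 1;
             2 *: 'X_1 ^+ 2 + (2 * lam) *: 'X_2 ^+ 2 - 1].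
  apply/seteqP; split=> p /=.
    case=> /= p1 p2 f; rewrite !inE => /orP[] /eqP ->;
    by rewrite /mpeval mevalB mevalD !mevalZ !rmorphXn /= !mevalXU meval1
      ?p1 ?p2 subrr.
  move=> Xp; have := Xp _ (mem_head _ _); have := Xp _ (mem_last _ _).
  rewrite /= /mpeval !mevalB !mevalD !mevalZ !rmorphXn /= !mevalXU meval1.
  by move=> /subr0_eq p2 /subr0_eq p1; split.
- exists (fun=> 'X_2) => F F0.
  (* Starting at 1/2 keeps [1 / 2 - k * x n ^+ 2] nonnegative for every [k] in [0, 1], so both
     remaining coordinates exist as real square roots. *)
  pose x n : R := (n.+2%:R)^-1.
  have x_inj : injective x.
    by move=> n m /invr_inj/eqP; rewrite eqr_nat !eqSS => /eqP.
  apply: (mpoly1_infinite_roots x_inj) => n.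
  have xn : x n ^+ 2 <= 1 / 2.
    have x0 : 0 <= x n by rewrite invr_ge0 ler0n.
    have xh : x n <= 1 / 2.
      by rewrite div1r lef_pV2 ?posrE ?ltr0n // ler_nat.
    by nra.
  have xn0 : 0 <= x n ^+ 2 by rewrite sqr_ge0.
  pose r k := Num.sqrt (1 / 2 - k * x n ^+ 2).
  have rE k : 0 <= k <= 1 -> r k ^+ 2 = 1 / 2 - k * x n ^+ 2.
    by move=> /andP[k0 k1]; rewrite sqr_sqrtr //; nra.
  pose p : 'rV[R]_3 := \row_i [:: r mu; r lam; x n]`_i.
  have Xp : X p.
    by split; rewrite /= !mxE /= rE; do ?[apply/andP; split]; lra.
  rewrite -[RHS](F0 p Xp); apply: meval_eq => i.
  by rewrite /mpeval mevalXU mxE.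
- move=> e f.
  pose q (k : R) : {poly R} := (1 / 2)%:P - k *: 'X^2.
  have q_size k : (size (q k) <= 3)%N.
    apply: leq_trans (size_polyD _ _) _.
    rewrite geq_max size_polyN (leq_trans (size_polyC_leq1 _)) //.
    by rewrite (leq_trans (size_scale_leq _ _)) // size_polyXn.
  have qE k y : (q k).[y] = 1 / 2 - k * y ^+ 2.
    by rewrite !hornerE.
  apply: (curve_independent_le1 (q_size mu) (q_size lam)) => p [/= p1 p2];
  by rewrite qE; lra.
Qed.

(** * The shape of each surface *)

Lemma dot_delta (R : realType) (n : nat) (x : 'rV[R]_n) (i : 'I_n) :
  dot (delta_mx 0 i) x = x 0 i.
Proof.
rewrite /dot (bigD1 i) //= big1 ?addr0 => [|j ji].
  by rewrite mxE !eqxx mul1r.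
by rewrite mxE (negbTE ji) andbF mul0r.
Qed.

(** For [k = 0] the equation factors into two planes at [h] and [- h]. For [k > 0] it is an ellipse
    in the coordinates [i], [j], with semi-axes [h] and [b], and coordinate [l] is free. *)
Lemma quadric_cylinder_or_planes (R : realType) (k : R) (i j l : 'I_3) :
  0 <= k -> uniq [:: i; j; l] ->
  let S := [set p : 'rV[R]_3 | 2 * p 0 i ^+ 2 + 2 * k * p 0 j ^+ 2 = 1] in
  elliptical_cylinder S \/ parallel_planes S.
Proof.
move=> k0 uijl S; pose h : R := Num.sqrt (1 / 2).
have h2 : h ^+ 2 = 1 / 2 by rewrite sqr_sqrtr //; lra.
have h0 : 0 < h by rewrite sqrtr_gt0; lra.
have /and3P[] := uijl; rewrite !inE negb_or => /andP[ij il] jl _.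
have [{}k0|k0'] := eqVneq k 0.
  rewrite /S; right; exists (delta_mx 0 i), h, (- h); split.
  - by apply/eqP => /rowP/(_ i)/eqP; rewrite !mxE !eqxx oner_eq0.
  - by apply/eqP; lra.
  apply/seteqP; split=> p /=; rewrite !dot_delta k0.
    move=> p1; have /eqP : p 0 i ^+ 2 = h ^+ 2 by lra.
    by rewrite eqf_sqr => /orP[] /eqP; [left|right].
  by case=> ->; rewrite ?sqrrN h2; lra.
have kp : 0 < k by rewrite lt_def k0' k0.
pose b : R := Num.sqrt (1 / (2 * k)).
have b2 : b ^+ 2 = 1 / (2 * k) by rewrite sqr_sqrtr // divr_ge0 //; lra.
have b0 : 0 < b by rewrite sqrtr_gt0 divr_gt0 //; lra.
have eqS x y : (x ^+ 2 / h ^+ 2 + y ^+ 2 / b ^+ 2 = 1) <->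
    (2 * x ^+ 2 + 2 * k * y ^+ 2 = 1).
  suff -> : x ^+ 2 / h ^+ 2 + y ^+ 2 / b ^+ 2 = 2 * x ^+ 2 + 2 * k * y ^+ 2 by [].
  by rewrite h2 b2; field.
rewrite /S; left; exists 0, (delta_mx 0 i), (delta_mx 0 j), (delta_mx 0 l), h, b.
split=> //.
- by split; rewrite dot_delta mxE !eqxx.
- by split; rewrite dot_delta mxE eqxx /=; apply/eqP; rewrite pnatr_eq0 eqb0.
apply/seteqP; split=> p /=.
  move=> p1; exists (p 0 i), (p 0 j), (p 0 l); split; first exact/eqS.
  rewrite add0r [LHS]row_sum_delta.
  rewrite (bigD1 i) //= (bigD1 j) 1?eq_sym //= (bigD1 l) /=; last first.
    by rewrite ![l == _]eq_sym il jl.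
  rewrite big1 ?addr0 ?addrA // => m mijl; exfalso.
  (* A further index would give four distinct elements of ['I_3]. *)
  have uijlm : uniq [:: m; i; j; l].
    by rewrite cons_uniq uijl !inE !negb_or andbA mijl.
  by have := max_card (mem [:: m; i; j; l]); rewrite (card_uniqP uijlm) card_ord.
case=> x [y [z [/eqS e ->]]].
rewrite !mxE !eqxx /= (eq_sym j i) (negbTE ij) (negbTE il) (negbTE jl) /=.
by rewrite !mulr1 !mulr0 !addr0 !add0r.
Qed.

(** * Lengths of the diagonals in coordinates *)

Lemma dot_ge0 (R : realType) (n : nat) (x : 'rV[R]_n) : 0 <= dot x x.
Proof. by apply: sumr_ge0 => i _; rewrite -expr2 sqr_ge0. Qed.

Lemma len_sqr (R : realType) (n : nat) (x : 'rV[R]_n) : len x ^+ 2 = dot x x.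
Proof. by rewrite sqr_sqrtr // dot_ge0. Qed.

Lemma dot_orthogonal_combination (R : realType) (n : nat) (x y : 'rV[R]_n)
    (a b : R) : dot x y = 0 ->
  dot (a *: x + b *: y) (a *: x + b *: y) = a ^+ 2 * dot x x + b ^+ 2 * dot y y.
Proof.
move=> xy0; transitivity
    (a ^+ 2 * dot x x + b ^+ 2 * dot y y + 2 * a * b * dot x y).
  rewrite /dot !mulr_sumr -!big_split /=; apply: eq_bigr => i _.
  by rewrite !mxE; ring.
by rewrite xy0 mulr0 addr0.
Qed.

Lemma dotC (R : realType) (n : nat) (x y : 'rV[R]_n) : dot x y = dot y x.
Proof. by apply: eq_bigr => i _; rewrite mulrC. Qed.

Lemma dot0 (R : realType) (n : nat) (x : 'rV[R]_n) : dot 0 x = 0.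
Proof. by rewrite /dot big1 // => i _; rewrite mxE mul0r. Qed.

Section Diagonals.
Variables (R : realType) (U V T : quad R).

Lemma diagAC_of_coords (p : 'rV[R]_3) :
  diagAC (of_coords U V T p) =
    p 0 0 *: diagAC U + p 0 1 *: diagAC V + p 0 2 *: diagAC T.
Proof. by rewrite /diagAC /vertA /vertC /=; apply/rowP => i; rewrite !mxE; ring. Qed.

Lemma diagBD_of_coords (p : 'rV[R]_3) :
  diagBD (of_coords U V T p) =
    p 0 0 *: diagBD U + p 0 1 *: diagBD V + p 0 2 *: diagBD T.
Proof. by rewrite /diagBD /vertB /vertD /=; apply/rowP => i; rewrite !mxE; ring. Qed.

End Diagonals.

Lemma of_coords_basis (R : realType) (W : set (quad R)) (U V T : quad R)
    (p : 'rV[R]_3) : is_basis W [:: U; V; T] -> W (of_coords U V T p).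
Proof.
case=> _ ->.
have inW (a : R) Q : Q \in [:: U; V; T] -> a *: Q \in <<[:: U; V; T]>>%VS.
  by move=> Qs; rewrite memvZ // memv_span.
by apply: memvD; [apply: memvD|]; apply: inW; rewrite !inE eqxx ?orbT.
Qed.

Theorem lemma3p2 (R : realType) (mA mB mC mD bA : R)
  (hABCD : ~ exists p : 'rV[R]_2,
     [/\ line mA bA p, line mB 1 p, line mC 0 p & line mD 0 p])
  (hCD : line mC 0 `&` line mD 0 = [set 0])
  (U V T : quad R)
  (hbasis : is_basis (Pi mA mB mC mD bA) [:: U; V; T])
  (hON : orthonormal3 U V T)
  (hUdeg : degenerate U) (hVdeg : degenerate V)
  (hUAC : diagAC U = 0) (hVBD : diagBD V = 0)
  (hTV : dot (diagAC T) (diagAC V) = 0)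
  (hTU : dot (diagBD T) (diagBD U) = 0)
  (lam mu : R)
  (hlam : lam = dot (diagAC T) (diagAC T))
  (hmu : mu = dot (diagBD T) (diagBD T)) :
  let unit_rectangles :=
    [set P | Pi mA mB mC mD bA P /\ unit_rectangle P] in
  let S1 := [set p : 'rV[R]_3 | 2 * p 0 0 ^+ 2 + 2 * mu * p 0 2 ^+ 2 = 1] in
  let S2 := [set p : 'rV[R]_3 | 2 * p 0 1 ^+ 2 + 2 * lam * p 0 2 ^+ 2 = 1] in
  [/\ algebraic_curve (in_coords U V T unit_rectangles),
      in_coords U V T unit_rectangles = S1 `&` S2,
      elliptical_cylinder S1 \/ parallel_planes S1,
      elliptical_cylinder S2 \/ parallel_planes S2
    & S1 = in_coords U V T
             [set P | Pi mA mB mC mD bA P /\ len (diagBD P) ^+ 2 = 1 / 2] /\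
      S2 = in_coords U V T
             [set P | Pi mA mB mC mD bA P /\ len (diagAC P) ^+ 2 = 1 / 2]].
Proof.
move=> unit_rectangles S1 S2.
have [[UU VV TT] _] := hON.
(* Each of [U] and [V] has one vanishing diagonal, so its other diagonal carries the whole unit
   norm. *)
have {}UU : dot (diagBD U) (diagBD U) = 1 by rewrite -UU /inner hUAC dot0 add0r.
have {}VV : dot (diagAC V) (diagAC V) = 1 by rewrite -VV /inner hVBD dot0 addr0.
have {TT} lam_mu : lam + mu = 1 by rewrite hlam hmu.
have lam0 : 0 <= lam by rewrite hlam dot_ge0.
have mu0 : 0 <= mu by rewrite hmu dot_ge0.
have AC p : len (diagAC (of_coords U V T p)) ^+ 2 =
    p 0 1 ^+ 2 + lam * p 0 2 ^+ 2.
  rewrite len_sqr diagAC_of_coords hUAC scaler0 add0r.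
  by rewrite dot_orthogonal_combination ?(dotC (diagAC V)) // VV -hlam; ring.
have BD p : len (diagBD (of_coords U V T p)) ^+ 2 =
    p 0 0 ^+ 2 + mu * p 0 2 ^+ 2.
  rewrite len_sqr diagBD_of_coords hVBD scaler0 addr0.
  by rewrite dot_orthogonal_combination ?(dotC (diagBD U)) // UU -hmu; ring.
have PiP p := of_coords_basis p hbasis.
have S1E p : S1 p <-> len (diagBD (of_coords U V T p)) ^+ 2 = 1 / 2.
  by rewrite BD /S1 /=; clear; split=> h; lra.
have S2E p : S2 p <-> len (diagAC (of_coords U V T p)) ^+ 2 = 1 / 2.
  by rewrite AC /S2 /=; clear; split=> h; lra.
have curveE : in_coords U V T unit_rectangles = S1 `&` S2.
  apply/seteqP; split=> p.
    case=> _ [[_ lenE] normE].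
    suff eBD : len (diagBD (of_coords U V T p)) ^+ 2 = 1 / 2.
      by split; [apply/S1E | apply/S2E; rewrite lenE].
    have := congr1 (fun x => x ^+ 2) normE.
    rewrite /qnorm sqr_sqrtr ?addr_ge0 ?dot_ge0 // /inner -!len_sqr lenE expr1n.
    by clear; lra.
  case=> /S1E eBD /S2E eAC; split; first exact: PiP.
  split; last by rewrite /qnorm /inner -!len_sqr eAC eBD -splitr sqrtr1.
  split; first by have [w []] := PiP p.
  (* Lengths are nonnegative, so equal squares give equal lengths. *)
  by apply/eqP; rewrite -(@eqrXn2 _ 2) ?sqrtr_ge0 // eAC eBD.
split.
(* The upper bounds on [lam] and [mu] follow from nonnegativity and [lam + mu = 1]. *)
- by rewrite curveE; apply: cylinders_meet_in_curve;
  rewrite ?lam0 ?mu0 -lam_mu ?lerDl ?lerDr.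
- exact: curveE.
(* The third index is the free direction: [v] for the first surface, [u] for the second. *)
- exact: (@quadric_cylinder_or_planes _ mu 0 2 1).
- exact: (@quadric_cylinder_or_planes _ lam 1 2 0).
split; apply/seteqP; split=> p.
- by move=> /S1E; split; first exact: PiP.
- by case=> _ /S1E.
- by move=> /S2E; split; first exact: PiP.
- by case=> _ /S2E.
Qed.
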